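(* Let $n\ge 2$ and let $E_1,\ldots,E_n$ be events with $E_1\cdots E_{n-1}\neq\emptyset$. Then, with the conjunction of conditional events understood as a conditional random quantity in the setting of coherence, $$E_1\cdots E_n=E_1\wedge(E_2|E_1)\wedge\cdots\wedge(E_n|E_1\cdots E_{n-1}),$$ and $$\mathbb{P}[E_1\wedge(E_2|E_1)\wedge\cdots\wedge(E_n|E_1\cdots E_{n-1})]=P(E_1)P(E_2|E_1)\cdots P(E_n|E_1\cdots E_{n-1}).$$
   Context: Events are elements of a Boolean algebra (sure event $\Omega$), $\overline{E}$ is negation, juxtaposition is conjunction of events, and an event is identified with its $\{0,1\}$-valued indicator; an unconditional event $E$ is identified with $E|\Omega$. $\mathbb{P}$ denotes prevision. For a random quantity $X$ with finitely many values, an event $H\neq\emptyset$ and an assessed prevision $\mu=\mathbb{P}(X|H)$, the conditional random quantity is $X|H=XH+\mu\overline{H}$; in particular the indicator of a conditional event is $A|H=AH+P(A|H)\overline{H}$. Equality of random quantities means equality of values in every case. Coherence: an assessment $(\mu_1,\ldots,\mu_k)$ on conditional random quantities $X_1|H_1,\ldots,X_k|H_k$ is coherent if for every nonempty $J\subseteq\{1,\ldots,k\}$ and all real $s_i$ $(i\in J)$, the values of $G=\sum_{i\in J}s_iH_i(X_i-\mu_i)$ restricted to $\bigvee_{i\in J}H_i$ satisfy $\min G\le 0\le\max G$. All probabilities and previsions involved (including those of the conjunctions of subfamilies and of the event $E_1\cdots E_n$) are assumed jointly coherent. Conjunction of $n$ conditional events: $\bigwedge_{i=1}^n(A_i|H_i)$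 is the conditional random quantity, with conditioning event $\bigvee_{i=1}^nH_i$, taking the value $1$ if $\bigwedge_{i=1}^nA_iH_i$ is true, $0$ if $\bigvee_{i=1}^n\overline{A}_iH_i$ is true, and $x_S$ if $(\bigwedge_{i\notin S}A_iH_i)\wedge(\bigwedge_{i\in S}\overline{H}_i)$ is true, for $\emptyset\neq S\subseteq\{1,\ldots,n\}$, where $x_S=\mathbb{P}[\bigwedge_{i\in S}(A_i|H_i)]$. This operation is commutative and associative. *)

(* Defs.v *)
From HB Require Import structures.
From mathcomp Require Import all_boot all_order all_algebra.
From mathcomp Require Export reals.

Set Implicit Arguments.
Unset Strict Implicit.
Unset Printing Implicit Defensive.

Import Order.Theory GRing.Theory Num.Theory.
Local Open Scope order_scope.
Local Open Scope ring_scope.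

Section ConditionalRandomQuantities.
Variables (d : Order.disp_t) (L : ctbDistrLatticeType d) (R : realType).

(* Events are the elements of L.  A case is a truth valuation on L, i.e. a
   Boolean homomorphism to bool (equivalently, an ultrafilter of L); by the
   prime ideal theorem, E != \bot iff E is true in some case.  On finitely many
   events, the valuations induce exactly their non-impossible constituents.
   (The library's {tblmorphism L -> bool} would not do: it preserves \bot and
   \top only, not meets and joins.) *)
Record case := Case {
  truth :> L -> bool;
  truthI : forall E F : L, truth (E `&` F)%O = truth E && truth F;
  truthC : forall E : L, truth (~` E)%O = ~~ truth E
}.

Lemma truthU (w : case) (E F : L) : w (E `|` F)%O = w E || w F.
Proof. by rewrite -[(E `|` F)%O]complK complU truthC truthI !truthC negb_and !negbK. Qed.

Lemma truth0 (w : case) : w \bot%O = false.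
Proof. by rewrite -(meetxC \bot%O) truthI truthC andbN. Qed.

Lemma truth1 (w : case) : w \top%O = true.
Proof. by rewrite -compl0 truthC truth0. Qed.

Definition rq := case -> R.

Definition ind (E : L) : rq := fun w => (w E : nat)%:R.

(* [CondRQ X H mu] is X|H together with its assessed prevision mu = P(X|H). *)
Record condRQ := CondRQ { quantity : rq; given : L; prevision : R }.

Definition condRQ_value (Z : condRQ) (w : case) : R :=
  quantity Z w * ind (given Z) w + prevision Z * ind (~` given Z)%O w.
Coercion condRQ_value : condRQ >-> Funclass.

Definition cond_event (A H : L) (p : R) : condRQ := CondRQ (ind A) H p.

Section Coherence.
Variables (I : finType) (Z : I -> condRQ).

Definition gain (J : {set I}) (s : I -> R) : rq := fun w =>
  \sum_(i in J) s i * ind (given (Z i)) w * (quantity (Z i) w - prevision (Z i)).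

(* min and max of X over the cases in which H is true, as attained values; they
   exist whenever H is possible and X takes finitely many values. *)
Definition is_min_on (H : L) (X : rq) (m : R) : Prop :=
  (exists2 w : case, w H & X w = m) /\ (forall w : case, w H -> m <= X w).

Definition is_max_on (H : L) (X : rq) (m : R) : Prop :=
  (exists2 w : case, w H & X w = m) /\ (forall w : case, w H -> X w <= m).

Definition coherent : Prop :=
  forall (J : {set I}) (s : I -> R), J != set0 ->
  exists m M : R,
    [/\ is_min_on (\join_(i in J) given (Z i))%O (gain J s) m,
        is_max_on (\join_(i in J) given (Z i))%O (gain J s) M
      & m <= 0 <= M].

End Coherence.

Section Conjunction.
(* [x S] is the assessed prevision of the conjunction of the A i | H i, i in S;
   in particular x [set i] = P(A i | H i).  The value x set0 is never used for
   nonempty conjunctions. *)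
Variables (n : nat) (A H : 'I_n -> L) (x : {set 'I_n} -> R).

(* In the last branch, the set of the i in S with H i false is the unique
   nonempty S' such that A i and H i are true for i in S :\: S' and H i is
   false for i in S'. *)
Definition conjunction_value (S : {set 'I_n}) : rq := fun w =>
  if w (\meet_(i in S) (A i `&` H i))%O then 1
  else if w (\join_(i in S) (~` A i `&` H i))%O then 0
  else x [set i in S | w (~` H i)%O].

Definition conjunction (S : {set 'I_n}) : condRQ :=
  CondRQ (conjunction_value S) (\join_(i in S) H i)%O (x S).

Lemma conjunction1 (i : 'I_n) :
  conjunction [set i] =1 cond_event (A i) (H i) (x [set i]).
Proof.
move=> w; rewrite /condRQ_value /= /conjunction_value !big_set1 /ind.
rewrite !(truthI, truthC).
case wH: (w (H i)); case wA: (w (A i)); rewrite /= ?mulr0 ?mulr1 ?add0r //.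
Qed.

End Conjunction.

Section Chain.
Variables (n : nat) (E : 'I_n -> L).

(* E_1 ... E_(i-1); it is \top (the sure event) for the first index, so that
   E_1 is read as E_1 | \top. *)
Definition past (i : 'I_n) : L := (\meet_(j < n | (j < i)%N) E j)%O.

Definition chain_conjunction (x : {set 'I_n} -> R) : {set 'I_n} -> condRQ :=
  conjunction E past x.

(* The conjunctions of all nonempty subfamilies of the E_i | E_1 ... E_(i-1)
   (the singletons being these conditional events themselves), with previsions
   x, and (at None) the event E_1 ... E_n, with probability p. *)
Definition chain_assessment (x : {set 'I_n} -> R) (p : R)
    (k : option {S : {set 'I_n} | S != set0}) : condRQ :=
  if k is Some K then chain_conjunction x (val K)
  else cond_event (\meet_(i < n) E i)%O \top%O p.

End Chain.
End ConditionalRandomQuantities.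

(* Main.v *)
Require Import Defs.
From mathcomp Require Import all_boot all_order all_algebra.
From mathcomp Require Import reals ring.

Import Order.Theory GRing.Theory Num.Theory.
Local Open Scope order_scope.
Local Open Scope ring_scope.

(** The conditioning events [past i] decrease with [i].  Hence, for the
    conjunction of a nonempty initial segment E_1, E_2 | E_1, ..., E_k | E_1...E_(k-1),
    no case is left undecided: as soon as some E_i fails, the first failing E_i
    lies in the segment and its own conditioning event is true, so that the
    conjunction is 0; and it is 1 otherwise.  The conjunction of an initial
    segment is therefore the indicator of E_1...E_k, with sure conditioning
    event ([quantity_initial], [given_initial]); for the whole chain this is the
    first claim.

    For the product rule, write y_k for the prevision of the k-th initial
    conjunction, and q for that of E_(k+1) | E_1...E_k.  Betting q on the k-th
    initial conjunction, -1 on the next one and 1 on E_(k+1) | E_1...E_k yields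
    the same gain y_(k+1) - q y_k in every case.  A constant gain vanishes by
    coherence ([coherent_const_gain]), so y_(k+1) = y_k q, and the product
    formula follows by induction on k. *)

Section Auxiliary.
Variables (d : Order.disp_t) (L : ctbDistrLatticeType d) (R : realType).
Implicit Type w : case L.

Lemma truth_meet w (I : finType) (P : pred I) (F : I -> L) :
  w (\meet_(i | P i) F i)%O = [forall (i | P i), w (F i)].
Proof.
rewrite (big_morph w (truthI w) (truth1 w)) big_all_cond.
by apply/allP/forallP => [h i|h i _]; [apply: h; rewrite mem_index_enum | apply: h].
Qed.

Lemma truth_join w (I : finType) (P : pred I) (F : I -> L) :
  w (\join_(i | P i) F i)%O = [exists (i | P i), w (F i)].
Proof.
rewrite (big_morph w (truthU w) (truth0 w)) big_has_cond.
apply/hasP/existsP => [[i _ h]|[i h]]; exists i => //; exact: mem_index_enum.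
Qed.

Section Gains.
Variables (I : finType) (Z : I -> condRQ L R).

(** A constant gain is both its own minimum and its own maximum. *)
Lemma coherent_const_gain (J : {set I}) (s : I -> R) (c : R) :
  coherent Z -> J != set0 -> (forall w, gain Z J s w = c) -> c = 0.
Proof.
move=> coh J0 gainc; have [m [M [[[u _ um] _] [[v _ vM] _]]]] := coh J s J0.
by rewrite -um -vM !gainc -eq_le => /eqP.
Qed.

(** Stakes are summed as point masses over the whole index type, so that a bet
    on several indices needs no proof that these are distinct. *)
Lemma gain_point (a : R) (k : I) w :
  gain Z [set: I] (fun i => a * (i == k)%:R) w =
  a * (ind R (given (Z k)) w * (quantity (Z k) w - prevision (Z k))).
Proof.
rewrite /gain (bigD1 k) ?inE //= eqxx mulr1 big1 ?addr0 ?mulrA // => i.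
by case/andP=> _ /negPf->; rewrite mulr0 !mul0r.
Qed.

Lemma gainD (J : {set I}) (s t : I -> R) w :
  gain Z J (fun i => s i + t i) w = gain Z J s w + gain Z J t w.
Proof. by rewrite /gain -big_split /=; apply: eq_bigr => i _; rewrite !mulrDl. Qed.

End Gains.

Section Chain.
Variables (n : nat) (E : 'I_n -> L) (x : {set 'I_n} -> R).

Definition initial (k : nat) : {set 'I_n} := [set i : 'I_n | (i < k)%N].

Definition prefix_meet (k : nat) : L := (\meet_(j < n | (j < k)%N) E j)%O.

Lemma truth_prefixS w (k : 'I_n) :
  w (prefix_meet k.+1) = w (prefix_meet k) && w (E k).
Proof.
rewrite !truth_meet; apply/forall_inP/andP => [h|[/forall_inP h Ek] i].
  by split; [apply/forall_inP => i ik; apply: h; apply: ltnW | apply: h].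
by rewrite ltnS leq_eqVlt => /orP[/eqP/val_inj->|/h].
Qed.

(** The first conditioning event is the empty meet, hence sure. *)
Lemma given_initial w (k : nat) :
  (0 < n)%N -> (0 < k)%N -> w (given (chain_conjunction E x (initial k))).
Proof.
move=> n0 k0; rewrite /= truth_join; apply/exists_inP.
by exists (Ordinal n0); rewrite ?inE // truth_meet; apply/forall_inP.
Qed.

(** An initial segment never calls on the previsions [x] of its subfamilies:
    the first failing E_i has a true conditioning event, so it refutes the
    conjunction. *)
Lemma quantity_initial w (k : nat) :
  quantity (chain_conjunction E x (initial k)) w = ind R (prefix_meet k) w.
Proof.
rewrite /= /conjunction_value /ind.
have [allE|] := boolP (w (prefix_meet k)).
  rewrite truth_meet in allE; move/forall_inP: allE => allE.
  rewrite truth_meet ifT //; apply/forall_inP => i; rewrite inE => ik.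
  rewrite truthI allE //= truth_meet; apply/forall_inP => j ji.
  by apply: allE; apply: ltn_trans ik.
rewrite [X in ~~ X]truth_meet => /forall_inPn[i0 i0k Ei0].
(* The first index at which the chain fails. *)
case: (@arg_minnP _ i0 (fun i => ~~ w (E i)) val Ei0) => i Ei imin.
have ik : i \in initial k by rewrite inE (leq_ltn_trans (imin _ Ei0)).
rewrite truth_meet ifF; last first.
  by apply/forall_inP => /(_ i ik); rewrite truthI (negPf Ei).
rewrite truth_join ifT //; apply/exists_inP; exists i => //.
rewrite truthI truthC Ei truth_meet; apply/forall_inP => j ji.
by apply: contraLR ji => /imin; rewrite -leqNgt.
Qed.

Lemma given_single w (k : 'I_n) :
  ind R (given (chain_conjunction E x [set k])) w = ind R (prefix_meet k) w.
Proof. by rewrite /= big_set1. Qed.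

Lemma quantity_single w (k : 'I_n) :
  w (prefix_meet k) ->
  quantity (chain_conjunction E x [set k]) w = ind R (E k) w.
Proof.
move=> wk; rewrite /= /conjunction_value !big_set1 !truthI truthC /ind.
by rewrite [w (past E k)]wk !andbT; case: (w (E k)).
Qed.

Lemma initial_neq0 (k : nat) : (0 < n)%N -> (0 < k)%N -> initial k != set0.
Proof. by move=> n0 k0; apply/set0Pn; exists (Ordinal n0); rewrite inE. Qed.

Lemma single_neq0 (k : 'I_n) : [set k] != set0.
Proof. by apply/set0Pn; exists k; rewrite inE. Qed.

(** If E_1...E_k is true, the three bets pay
    q (1 - y_k) - (E_(k+1) - y_(k+1)) + (E_(k+1) - q); if it is false, the third
    is called off and they pay - q y_k + y_(k+1).  The two amounts agree. *)
Lemma prevision_initialS (p : R) (k : 'I_n) :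
  coherent (chain_assessment E x p) -> (0 < k)%N ->
  x (initial k.+1) = x (initial k) * x [set k].
Proof.
move=> coh k0; have n0 : (0 < n)%N := leq_ltn_trans (leq0n k) (ltn_ord k).
pose sub (S : {set 'I_n}) (S0 : S != set0) :
  option {S : {set 'I_n} | S != set0} := Some (Sub S S0).
pose iT := sub _ (initial_neq0 k n0 k0).
pose iT' := sub _ (initial_neq0 k.+1 n0 isT).
pose i1 := sub _ (single_neq0 k).
(* The stakes q, -1 and 1 cancel E_1...E_k and E_1...E_(k+1) in the gain. *)
pose s i : R := x [set k] * (i == iT)%:R + (-1 * (i == iT')%:R + 1 * (i == i1)%:R).
apply/eqP; rewrite -subr_eq0; apply/eqP.
apply: (@coherent_const_gain _ _ [set: _] s _ coh).
  by apply/set0Pn; exists iT; rewrite inE.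
move=> w; rewrite /s !gainD !gain_point /chain_assessment ![val _]/=.
rewrite !quantity_initial given_single.
rewrite {1 3}/ind !given_initial // ![prevision _]/=.
rewrite {1 2}/ind truth_prefixS {1}/ind.
have [wk|_] := boolP (w (prefix_meet k)); last by rewrite /=; ring.
by rewrite quantity_single // /ind; case: (w (E k)) => /=; ring.
Qed.

Lemma prevision_initial (p : R) (k : nat) :
  coherent (chain_assessment E x p) -> (k < n)%N ->
  x (initial k.+1) = \prod_(i < n | (i < k.+1)%N) x [set i].
Proof.
move=> coh; elim: k => [|k IHk] kn.
  rewrite (big_pred1 (Ordinal kn)) => [|i]; last by rewrite ltnS leqn0.
  by congr x; apply/setP => i; rewrite !inE ltnS leqn0.
rewrite (prevision_initialS p (Ordinal kn)) // IHk ?(ltnW kn) //.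
rewrite [RHS](bigD1 (Ordinal kn)) //= mulrC; congr (_ * _).
by apply: eq_bigl => i; rewrite -val_eqE /= [(i < k.+2)%N]ltnS andbC -ltn_neqAle.
Qed.

Lemma initial_full : initial n = [set: 'I_n].
Proof. by apply/setP => i; rewrite !inE ltn_ord. Qed.

Lemma prefix_meet_full : prefix_meet n = (\meet_(i < n) E i)%O.
Proof. by apply: eq_bigl => i; rewrite ltn_ord. Qed.

End Chain.
End Auxiliary.

Theorem mainTheorem8 (d : Order.disp_t) (L : ctbDistrLatticeType d)
    (R : realType) (n : nat) (n_ge2 : (2 <= n)%N) (E : 'I_n -> L)
    (E_possible : (\meet_(j < n | (j < n.-1)%N) E j)%O != \bot%O)
    (x : {set 'I_n} -> R) (p : R)
    (coh : coherent (chain_assessment E x p)) :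
  (forall w : case L,
      ind R (\meet_(i < n) E i)%O w = chain_conjunction E x [set: 'I_n] w) /\
  prevision (chain_conjunction E x [set: 'I_n]) =
    \prod_(i < n) prevision (chain_conjunction E x [set i]).
Proof.
have n0 : (0 < n)%N := ltnW n_ge2.
split=> [w|].
  rewrite -initial_full /condRQ_value quantity_initial prefix_meet_full.
  by rewrite /ind truthC given_initial // mulr1 mulr0 addr0.
have := @prevision_initial _ _ _ _ E x p n.-1 coh.
rewrite prednK // initial_full => /(_ (leqnn n)) /= ->.
by apply: eq_bigl => i; rewrite ltn_ord.
Qed.
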